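(* Every $w_s$-$q_f$-space $X$ is $\mu^{\#}_b$-complete; that is, every subset of $C_p(X)$ that is bounded in $C_p(X)$ has compact closure in $C_p(X)$.
   Context: All spaces are Tychonoff. $C_p(X)$ is the space of continuous real-valued functions on $X$ with the topology of pointwise convergence. A subset $Y$ of a space $T$ is bounded in $T$ if every continuous function $T\to\mathbb R$ is bounded on $Y$. $\mathcal P_s(X)$ is the family of all separable subspaces of $X$. Subsets $A,B$ of $X$ are functionally separated if there is a continuous $g:X\to[0,1]$ with $g(A)\subset\{0\}$ and $g(B)\subset\{1\}$. The game $\Gamma(AV(X,x,A,\lambda),I_f)$: let $A\subset X$, $x\in\overline A\setminus A$, and let $\lambda$ be a cover of $X$. Two players $\alpha$ and $\beta$ play for countably many steps $n=0,1,2,\dots$. At step $n$, player $\beta$ chooses a neighborhood $V_n$ of $x$, then player $\alpha$ chooses $S_n\subset A$ such that $S_n\subset L$ for some $L\in\lambda$. Player $\alpha$ wins if there exists $S\subset\bigcap_n V_n$ such that $S\subset L$ for some $L\in\lambda$ and the sets $S$ and $\bigcup_n S_n$ are not functionally separated. Strategies may depend on all previous moves; the game is $\beta$-unfavorable if $\beta$ has no winning strategy. $X$ is a $w$-$q_f$-space with respect to $\lambda$ if for every discontinuous function $f:X\to\mathbb R$ there are a non-closed $A\subset X$ and a point $x\in\overline A\setminus A$ such that $f(x)\notin\overline{f(A)}$ and the game $\Gamma(AV(X,x,A,\lambda),I_f)$ is $\beta$-unfavorable. $X$ is a $w_s$-$q_f$-space if it is a $w$-$q_f$-space with respect to $\mathcal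 P_s(X)$. *)

(* Defs.v *)
From HB Require Import structures.
From mathcomp Require Import all_boot all_order all_algebra.
From mathcomp Require Import all_classical all_reals all_analysis.

Set Implicit Arguments.
Unset Strict Implicit.
Unset Printing Implicit Defensive.

Import Order.TTheory GRing.Theory Num.Theory.
Import numFieldNormedType.Exports.
Local Open Scope classical_set_scope.
Local Open Scope ring_scope.

(* [completely_regular_space] is phrased with uniform separators; by
   [uniform_separatorP] these are the continuous [0, 1]-valued separators. *)
Definition tychonoff_space (X : topologicalType) : Prop :=
  hausdorff_space X /\ completely_regular_space X.

Definition separable_space (T : topologicalType) : Prop :=
  exists D : set T, countable D /\ dense D.

(* [set_type L] carries the subspace topology inherited from [X]. *)
Definition separable_subspaces (X : topologicalType) : set (set X) :=
  [set L | separable_space (set_type L)].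

Definition Cp (R : realType) (X : topologicalType) : Type :=
  continuousType X R.

HB.instance Definition _ (R : realType) (X : topologicalType) :=
  Topological.copy (Cp R X)
    (initial_topology
       (fun f : continuousType X R => (f : X -> R) : {ptws X -> R})).

Definition bounded_in (R : realType) (T : topologicalType) (Y : set T) : Prop :=
  forall g : T -> R, continuous g -> [bounded g t | t in Y].

Definition mu_sharp_b_complete (R : realType) (X : topologicalType) : Prop :=
  forall B : set (Cp R X), bounded_in R B -> compact (closure B).

Definition functionally_separated (R : realType) (X : topologicalType)
    (A B : set X) : Prop :=
  exists g : X -> R, [/\ continuous g, range g `<=` `[0, 1]%classic,
    g @` A `<=` [set 0] & g @` B `<=` [set 1]].

Section AV_game.
Context (R : realType) (X : topologicalType).
Implicit Types (x : X) (A : set X) (lambda : set (set X)) (V S : nat -> set X).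

Definition subset_of_member lambda (S : set X) : Prop :=
  exists L, lambda L /\ S `<=` L.

Definition alpha_move A lambda (S : set X) : Prop :=
  S `<=` A /\ subset_of_member lambda S.

Definition alpha_wins lambda V S : Prop :=
  exists S' : set X, [/\ S' `<=` \bigcap_n V n, subset_of_member lambda S' &
    ~ functionally_separated R S' (\bigcup_n S n)].

(* The moves of both players before step [n], in chronological order. *)
Definition history V S (n : nat) : seq (set X * set X) :=
  mkseq (fun i => (V i, S i)) n.

(* A strategy answers every history, including those that no legal play
   produces; this is harmless since [setT] is always available as an answer. *)
Definition beta_strategy x (sigma : seq (set X * set X) -> set X) : Prop :=
  forall h, nbhs x (sigma h).

Definition beta_winning_strategy x A lambda
    (sigma : seq (set X * set X) -> set X) : Prop :=
  beta_strategy x sigma /\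
  forall V S, (forall n, V n = sigma (history V S n)) ->
    (forall n, alpha_move A lambda (S n)) -> ~ alpha_wins lambda V S.

Definition beta_unfavorable x A lambda : Prop :=
  ~ exists sigma, beta_winning_strategy x A lambda sigma.

Definition w_qf_space lambda : Prop :=
  forall f : X -> R, ~ continuous f ->
  exists (A : set X) (x : X),
    [/\ ~ closed A, (closure A `\` A) x, ~ closure (f @` A) (f x) &
        beta_unfavorable x A lambda].

End AV_game.

Definition ws_qf_space (R : realType) (X : topologicalType) : Prop :=
  w_qf_space R (@separable_subspaces X).

(* The game is only meant for covers [lambda] of [X]; the family of separable
   subspaces is one. *)
Lemma separable_subspaces_cover (X : topologicalType) :
  \bigcup_(L in @separable_subspaces X) L = [set: X].
Proof.
apply/seteqP; split => // x _; exists [set x] => //.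
exists [set exist _ x (mem_set (erefl x))]; split; first exact: countable1.
move=> O [[y hy] Oy] _; exists (exist _ y hy); split => //=.
by apply: val_inj; exact: (set_mem hy).
Qed.

(* Main.v *)
Require Import Defs.
From mathcomp Require Import all_boot all_order all_algebra.
From mathcomp Require Import all_classical all_reals all_analysis.
From mathcomp Require Import lra.

Set Implicit Arguments.
Unset Strict Implicit.
Unset Printing Implicit Defensive.

Import Order.TTheory GRing.Theory Num.Theory.
Import numFieldNormedType.Exports.
Local Open Scope classical_set_scope.
Local Open Scope ring_scope.

(* Let [f] be a pointwise cluster point of a bounded set [B] of C_p(X). Boundedness
   is used through continuous functions on all of C_p(X): for every countable [D],
   some continuous function on the whole of [X] agrees with [f] on [D], hence on
   the closure of [D]. If [f] is discontinuous, take [A] and [x] from the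
   hypothesis. Player [beta] picks [g_n] in [B] such that [g_n] tends to [f] at [x]
   and on dense subsets of the separable sets containing the moves of [alpha]; the
   n-th neighbourhood is the set where [g_0], ..., [g_n] are within 1/(n + 1) of
   their values at [x], so every [g_n] is constant on any [S] contained in all the
   neighbourhoods. A cluster point [f'] of the [g_n] agrees, on any separable set,
   with a continuous [h] on [X]; this [h] equals [f] on every [S_n] and the constant
   [f x] on [S], so it functionally separates them, as [f] stays away from [f x] on
   [A]. Hence [beta] wins, a contradiction. So all pointwise cluster points are
   continuous and Tychonoff's theorem applies. *)

(** * Cluster points and approximation in the topology of pointwise convergence *)

Lemma inv_succ_lt (R : realType) (e : R) : 0 < e ->
  exists N, forall n, (N <= n)%N -> n.+1%:R^-1 < e.
Proof.
move=> e0; have [N _ NP] := near_infty_natSinv_lt (PosNum e0).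
by exists N => n /NP.
Qed.

Lemma eq_dist_lt (R : realType) (a b : R) :
  (forall e, 0 < e -> `|a - b| < e) -> a = b.
Proof.
move=> ab; apply/eqP; rewrite -subr_eq0 -normr_le0 leNgt; apply/negP => /ab.
by rewrite ltxx.
Qed.

(* [f] lies in the closure of [P] for the topology of pointwise convergence. *)
Definition approximable (R : realType) (X : eqType) (P : set (X -> R))
    (f : X -> R) : Prop :=
  forall (s : seq X) (e : R), 0 < e ->
    exists2 g, P g & forall y, y \in s -> `|g y - f y| < e.

(** The product of the segments [[- M y, M y]] is compact by Tychonoff's theorem. *)
Lemma cluster_ptws_bounded (R : realType) (X : topologicalType)
    (F : set_system {ptws X -> R}) (M : X -> R) : ProperFilter F ->
  F [set g | forall y, `|g y| <= M y] -> cluster F !=set0.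
Proof.
move=> FF FM.
have cM : forall y : X, compact (`[- M y, M y]%classic : set R).
  by move=> y; exact: segment_compact.
have /(_ F FF)[|f [_ ?]] := @tychonoff X (fun _ => R : topologicalType) _ cM.
  apply: filterS FM => g gM y /=.
  by rewrite in_itv /= -ler_norml; exact: gM.
by exists f.
Qed.

Lemma nbhs_ptws_seq (R : realType) (X : topologicalType) (f : {ptws X -> R})
    (s : seq X) (e : R) : 0 < e ->
  \forall g \near f, forall y, y \in s -> `|g y - f y| < e.
Proof.
move=> e0; have ff : Filter (nbhs f) by exact: nbhs_filter.
elim: s => [|a s IH].
  by apply: (@filterS _ (nbhs f) _ setT); last exact: filterT.
have fa : \forall g \near f, `|g a - f a| < e.
  apply: (@cvgr_distC_lt R R _ (nbhs f) _ (fun g => g a) (f a)) => //.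
  exact: (@proj_continuous _ (fun _ : X => R : topologicalType) a f).
by apply: filterS2 fa IH => g ga gs y; rewrite inE => /predU1P[->//|/gs].
Qed.

Lemma cluster_approximable (R : realType) (X : topologicalType)
    (F : set_system {ptws X -> R}) (f : {ptws X -> R}) (P : set (X -> R)) :
  cluster F f -> F P -> approximable P f.
Proof.
move=> Ff FP s e e0.
by have [g [Pg gf]] := Ff _ _ FP (nbhs_ptws_seq f s e0); exists g.
Qed.

Lemma bounded_in_ex (R : realType) (T : topologicalType) (Y : set T)
    (g : T -> R) :
  bounded_in R Y -> continuous g -> exists M, forall t, Y t -> `|g t| <= M.
Proof.
move=> bY gc.
have : \forall M \near +oo, forall t, Y t -> `|g t| <= M by exact: bY.
by move=> /filter_ex.
Qed.

(** * Bounded subsets of C_p(X) and interpolation along a sequence *)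

Section Cp_facts.
Context (R : realType) (X : topologicalType).

Definition Cp_val (b : Cp R X) : {ptws X -> R} := (b : X -> R).

Lemma Cp_val_continuous : continuous Cp_val.
Proof. exact: initial_continuous. Qed.

Lemma nbhs_Cp_seq (b : Cp R X) (s : seq X) (e : R) : 0 < e ->
  nbhs b [set c : Cp R X | forall y, y \in s -> `|c y - b y| < e].
Proof.
move=> e0; exact: (Cp_val_continuous (nbhs_ptws_seq (Cp_val b) s e0)).
Qed.

Lemma closure_Cp_approximable (B : set (Cp R X)) (f : X -> R) :
  approximable (Cp_val @` closure B) f -> approximable (Cp_val @` B) f.
Proof.
move=> Bf s e e0; have e2 : 0 < e / 2 by rewrite divr_gt0.
have [_ [b Bb <-] bf] := Bf s _ e2.
have [c [Bc cb]] := Bb _ (nbhs_Cp_seq b s e2).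
exists (Cp_val c) => [|y ys]; first by exists c.
rewrite [_ - _](_ : _ = (c y - b y) + (Cp_val b y - f y)); last first.
  by rewrite /Cp_val; lra.
by rewrite (le_lt_trans (ler_normD _ _))// [e]splitr ltrD ?cb ?bf.
Qed.

Lemma bounded_in_pointwise (B : set (Cp R X)) : bounded_in R B ->
  exists M : X -> R, forall b y, B b -> `|b y| <= M y.
Proof.
move=> Bb; suff /choice[M MP] : forall y : X, exists m : R,
    forall b, B b -> `|b y| <= m by exists M => b y /MP.
move=> y; have /(bounded_in_ex Bb)[m mP] : continuous (fun b : Cp R X => b y).
  move=> b; apply/(@cvgrPdistC_lt _ _ _ (nbhs b) (nbhs_filter b)) => e e0.
  apply: (@filterS _ (nbhs b)) (nbhs_Cp_seq b [:: y] e0) => c.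
  by apply; rewrite inE.
by exists m.
Qed.

Let rho_set (f : X -> R) (d : nat -> X) (g : X -> R) : set R :=
  range (fun n => Num.min n.+1%:R^-1 `|g (d n) - f (d n)|).

Let rho f d g := sup (rho_set f d g).

Let rho_ub f d g n : Num.min n.+1%:R^-1 `|g (d n) - f (d n)| <= rho f d g.
Proof.
apply: ub_le_sup; last by exists n.
by exists 1 => _ [k _ <-]; rewrite ge_min invf_le1 ?ler1n.
Qed.

Let rho_le f d g r :
  (forall n, Num.min n.+1%:R^-1 `|g (d n) - f (d n)| <= r) -> rho f d g <= r.
Proof.
move=> le_r; apply: ge_sup => [|_ [n _ <-]//].
by exists (Num.min 1%:R^-1 `|g (d 0%N) - f (d 0%N)|), 0%N.
Qed.

(** Terms of index at least [N] are below [e] for every [g], so only finitely many points matter;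
    this makes [rho] continuous for pointwise convergence. *)
Let rho_near f d g h (e : R) N : (forall n, (N <= n)%N -> n.+1%:R^-1 < e) ->
  (forall y, y \in mkseq d N -> `|g y - h y| < e) ->
  rho f d g <= rho f d h + e.
Proof.
move=> Ne gh; apply: rho_le => n.
have e0 : 0 < e by apply: lt_trans (Ne N (leqnn _)); rewrite invr_gt0.
have rho0 : 0 <= rho f d h.
  by apply: le_trans (rho_ub f d h 0); rewrite le_min normr_ge0 invr_ge0 ler0n.
have [/Ne le_n|n_lt] := leqP N n.
  by rewrite ge_min (le_trans (ltW le_n)) // lerDr.
have {gh} : `|g (d n) - h (d n)| < e.
  by apply: gh; apply/mapP; exists n; rewrite ?mem_iota.
have := rho_ub f d h n; rewrite ge_min => /orP[hn _|hn ghn].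
  by rewrite ge_min (le_trans hn)// lerDl ltW.
rewrite ge_min; apply/orP; right.
have := ler_distD (h (d n)) (g (d n)) (f (d n)).
by move: hn ghn; lra.
Qed.

(* If no continuous function agreed with [f] along [d], the inverse of the
   pseudodistance [sup_n min (1 / (n + 1)) |g (d n) - f (d n)|] would be a
   continuous function of [g], unbounded on [B]. *)
Lemma bounded_in_interpolation (B : set (Cp R X)) (f : X -> R) (d : nat -> X) :
  bounded_in R B -> approximable (Cp_val @` B) f ->
  exists2 h : X -> R, continuous h & forall n, h (d n) = f (d n).
Proof.
move=> Bb Bf; apply: contrapT => no_h.
have rho_gt0 (g : Cp R X) : 0 < rho f d g.
  rewrite ltNge; apply/negP => rho0; apply: no_h.
  exists g => [|n]; first exact: cts_fun.
  apply/eqP; rewrite -subr_eq0 -normr_le0.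
  have := le_trans (rho_ub f d g n) rho0; rewrite ge_min => /orP[|//].
  by rewrite leNgt invr_gt0 ltr0n.
have rho_cont : continuous (fun g : Cp R X => rho f d g).
  move=> g; apply/(@cvgrPdistC_le _ _ _ (nbhs g) (nbhs_filter g)) => e e0.
  have [N NP] := inv_succ_lt e0.
  apply: (@filterS _ (nbhs g)) (nbhs_Cp_seq g (mkseq d N) e0) => c cg.
  have := rho_near f NP cg.
  have /(rho_near f NP) : forall y, y \in mkseq d N -> `|g y - c y| < e.
    by move=> y /cg; rewrite distrC.
  by rewrite ler_norml; lra.
have /(bounded_in_ex Bb)[M MP] : continuous (fun g : Cp R X => (rho f d g)^-1).
  move=> g; apply: (@cvgV _ _ (nbhs g) (nbhs_filter g)).
    by rewrite gt_eqF.
  exact: rho_cont.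
(* A value of [rho] below this [e] has an inverse above [|M| + 1], hence above [M]. *)
pose e := (`|M| + 1)^-1.
have e0 : 0 < e / 2 by rewrite divr_gt0// invr_gt0 ltr_wpDl.
have [N NP] := inv_succ_lt e0.
have [_ [b /MP bM <-] bf] := Bf (mkseq d N) _ e0.
have := rho_near f NP bf.
have ff : rho f d f <= 0.
  by apply: rho_le => n; rewrite subrr normr0 ge_min lexx orbT.
move=> rf; suff : M < (rho f d b)^-1.
  by rewrite ltNge => /negP; apply; apply: le_trans bM; exact: ler_norm.
have : rho f d b < e by move: rf e0; rewrite /Cp_val; lra.
rewrite -ltf_pV2 ?posrE ?invr_gt0 ?ltr_wpDl ?rho_gt0// invrK; apply: le_lt_trans.
by have := ler_norm M; lra.
Qed.

End Cp_facts.
Arguments Cp_val {R X}.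

(** The sequence enumerates a countable dense subset of the separable set around [S]; [x0] is a
    dummy value for when that subset is empty. *)
Lemma separable_determining (R : realType) (X : topologicalType) (S : set X) :
  subset_of_member (@separable_subspaces X) S -> X ->
  exists d : nat -> X, forall u v : X -> R, continuous u -> continuous v ->
    (forall n, u (d n) = v (d n)) -> {in S, u =1 v}.
Proof.
move=> [L [[D [Dc Dd]] SL]] x0.
have [d dP] : exists d : nat -> X, forall z, D z -> exists n, d n = set_val z.
  have [D0|] := eqVneq D set0; first by exists (fun=> x0); rewrite D0.
  move=> /set0P Dn0; move/pfcard_geP : Dc => [D0|[e]].
    by case: Dn0 => z; rewrite D0.
  exists (set_val \o e) => z /(@surj _ _ _ _ e)[n _ <-].
  by exists n.
exists d => u v cu cv uv s; rewrite inE => /SL Ls; apply: contrapT => uvs.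
pose w y := u y - v y.
have cw : continuous w by move=> y; apply: cvgB; [exact: cu|exact: cv].
have wo : open [set z : set_type L | w (set_val z) != 0].
  have : open (w @^-1` [set r | r != 0]).
    by apply: open_comp; [move=> y _; exact: cw|exact: open_neq].
  by exists (w @^-1` [set r | r != 0]).
have [|z [/= wz /dP[n dn]]] := Dd _ _ wo.
  exists (exist _ s (mem_set Ls)) => /=; rewrite subr_eq0.
  by apply/negP => /eqP.
by move: wz; rewrite -dn /w uv subrr eqxx.
Qed.

(** * Continuity of the pointwise cluster points, by way of the game *)

Section pointwise_cluster_points.
Context (R : realType) (X : topologicalType) (B : set (Cp R X))
  (bB : bounded_in R B).

(** Although [f] may be discontinuous, a continuous [k] interpolates it at [s] and along [d]
    together; [h] and [k] agree along [d], hence at [s]. *)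
Lemma agree_on_separable (S : set X) (f h : X -> R) (d : nat -> X) :
    (forall u v : X -> R, continuous u -> continuous v ->
      (forall n, u (d n) = v (d n)) -> {in S, u =1 v}) ->
    approximable (Cp_val @` B) f -> continuous h ->
  (forall n, h (d n) = f (d n)) -> {in S, h =1 f}.
Proof.
move=> dS Bf ch hf s Ss.
pose ds n := if n is m.+1 then d m else s.
have [k ck kf] := bounded_in_interpolation ds bB Bf.
rewrite -(kf 0%N) /=; apply: (dS h k) => // n.
by rewrite hf -(kf n.+1).
Qed.

Lemma not_closure_dist (A : set X) (f : X -> R) (x : X) :
  ~ closure (f @` A) (f x) ->
  exists2 e, 0 < e & forall a, A a -> e <= `|f a - f x|.
Proof.
move=> nc; apply: contrapT => ne; apply: nc => U /nbhs_ballP[e /= e0 eU].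
apply: contrapT => AU; apply: ne; exists e => // a Aa.
rewrite leNgt; apply/negP => ae; apply: AU; exists (f a).
by split; [exists a|apply: eU; rewrite /ball/= distrC].
Qed.

Lemma take_history (V S : nat -> set X) k n : (k <= n)%N ->
  take k (history V S n) = history V S k.
Proof.
by move=> kn; rewrite /history /mkseq -map_take take_iota (minn_idPl kn).
Qed.

Lemma bounded_sequence_cluster (G : nat -> X -> R) :
    (forall n, (Cp_val @` B) (G n)) ->
  exists2 f : X -> R, approximable (Cp_val @` B) f &
    forall y c, (exists N, forall n, (N <= n)%N -> `|G n y - c| < n.+1%:R^-1) ->
      f y = c.
Proof.
move=> BG; have [M MP] := bounded_in_pointwise bB.
pose F : set_system {ptws X -> R} := G @ \oo.
have FF : ProperFilter F by exact: fmap_proper_filter.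
have [] := @cluster_ptws_bounded R X F M FF.
  by exists 0%N => // n _ y; have [b Bb <-] := BG n; exact: MP.
move=> f Ff; exists f.
  by apply: cluster_approximable Ff _; exists 0%N => // n _; exact: BG.
move=> y c [N NP]; apply: eq_dist_lt => e e0.
have e2 : 0 < e / 2 by rewrite divr_gt0.
have [K KP] := inv_succ_lt e2.
have FK : F (G @` [set n | (maxn N K <= n)%N]).
  by exists (maxn N K) => // n /= le_n; exists n.
have [_ [n /= le_n <-] /(_ y)] := cluster_approximable Ff FK [:: y] e2.
rewrite inE eqxx => /(_ isT) Gf.
move: le_n; rewrite geq_max => /andP[/NP Gc /KP nK].
rewrite (_ : f y - c = - (G n y - f y) + (G n y - c)); last by lra.
rewrite (le_lt_trans (ler_normD _ _))// normrN [e]splitr ltrD//.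
exact: lt_trans nK.
Qed.

Lemma ws_qf_cluster_continuous (f : X -> R) : ws_qf_space R X ->
  approximable (Cp_val @` B) f -> continuous f.
Proof.
move=> Xws Bf; apply: contrapT.
move=> /Xws[A [x [_ _ /not_closure_dist[eps eps0 fA] unfav]]]; apply: unfav.
have /choice[e eP] : forall S : set X, exists d : nat -> X,
    subset_of_member (@separable_subspaces X) S ->
    forall u v : X -> R, continuous u -> continuous v ->
    (forall n, u (d n) = v (d n)) -> {in S, u =1 v}.
  move=> S; have [/(separable_determining R)/(_ x)[d dP]|nS] :=
    pselect (subset_of_member (@separable_subspaces X) S); first by exists d.
  by exists (fun=> x).
(* Finitely many points per step: the point [e (S i) j] is listed as soon as the step exceeds both
   [i] and [j]. *)
pose pts (h : seq (set X * set X)) :=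
  x :: [seq e p.2 j | p <- h, j <- iota 0 (size h)].
have /choice[gam gamP] : forall h : seq (set X * set X), exists g : X -> R,
    (Cp_val @` B) g /\
    forall y, y \in pts h -> `|g y - f y| < (size h).+1%:R^-1.
  move=> h; have [|g Bg gf] := Bf (pts h) (size h).+1%:R^-1.
    by rewrite invr_gt0.
  by exists g.
have gam_cont h : continuous (gam h).
  by have [[b _ <-] _] := gamP h; exact: cts_fun.
(* The earlier functions are recovered from the prefixes [take k h]; [k = size h] gives the current
   one. *)
pose sigma (h : seq (set X * set X)) : set X :=
  [set y | forall k : 'I_(size h).+1,
    `|gam (take k h) y - gam (take k h) x| < (size h).+1%:R^-1].
exists sigma; split.
  move=> h; apply: filter_forall => k.
  by apply: cvgr_distC_lt; [exact: gam_cont|rewrite invr_gt0].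
move=> V S VP SP [S' [S'V S'L nsep]].
pose G n := gam (history V S n).
have GP n y : y \in pts (history V S n) -> `|G n y - f y| < n.+1%:R^-1.
  by move=> yn; have := (gamP _).2 _ yn; rewrite size_mkseq.
(* [G n] enters every neighbourhood from step [n] on, with tolerances tending to 0. *)
have GS' y n : S' y -> G n y = G n x.
  move=> /S'V yV; apply: eq_dist_lt => r /inv_succ_lt[N NP].
  have := yV (maxn N n) I; rewrite VP /sigma /= size_mkseq => yk.
  have kn : (n < (maxn N n).+1)%N by rewrite ltnS leq_maxr.
  have := yk (Ordinal kn); rewrite /= take_history ?leq_maxr//.
  by move=> /lt_trans; apply; apply: NP; exact: leq_maxl.
have [f' Bf' f'P] := bounded_sequence_cluster (fun n => (gamP (history V S n)).1).
have f'S' y : S' y -> f' y = f x.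
  move=> S'y; apply: f'P; exists 0%N => n _; rewrite -/(G n) GS'//.
  by apply: GP; rewrite inE eqxx.
have f'S i j : f' (e (S i) j) = f (e (S i) j).
  apply: f'P; exists (maxn i.+1 j.+1) => n; rewrite geq_max => /andP[ni nj].
  apply: GP; rewrite inE; apply/orP; right; apply/allpairsPdep.
  exists (V i, S i), j; rewrite size_mkseq mem_iota /=; split => //.
  by apply/mapP; exists i; rewrite ?mem_iota.
(* One sequence runs through the points for [S'] (first index 0) and for every [S i] (first index
   [i.+1]), so a single [h] serves all these sets. *)
pose d k := match (unpickle k : option (nat * nat)) with
  | Some (i.+1, j) => e (S i) j | Some (0%N, j) => e S' j | None => x end.
have [h ch hf'] := bounded_in_interpolation d bB Bf'.
have hS' y : S' y -> h y = f x.
  move=> S'y; rewrite -(f'S' _ S'y).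
  apply: (agree_on_separable (eP _ S'L) Bf' ch); last exact: mem_set.
  by move=> n; have := hf' (pickle (0%N, n)); rewrite /d pickleK.
have hS i y : S i y -> h y = f y.
  move=> Sy; apply: (agree_on_separable (eP _ (SP i).2) Bf ch); last exact: mem_set.
  by move=> n; have := hf' (pickle (i.+1, n)); rewrite /d pickleK f'S.
apply: nsep; exists (fun y => Num.min 1 (`|h y - f x| / eps)); split.
- move=> y; apply: (@continuous_min R X (fun=> 1) (fun z => `|h z - f x| / eps)).
    exact: cst_continuous.
  apply: cvgM; last exact: cvg_cst.
  apply: cvg_norm; apply: cvgB; [exact: ch|exact: cvg_cst].
- move=> _ [y _ <-] /=; rewrite in_itv /= le_min ler01 ge_min lexx/= andbT.
  by rewrite divr_ge0// ltW.
- move=> _ [y /hS' -> <-] /=; rewrite subrr normr0 mul0r.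
  by rewrite min_r.
- move=> _ [y [n _ Sy] <-] /=; rewrite (hS _ _ Sy) min_l//.
  by rewrite ler_pdivlMr// mul1r fA//; exact: (SP n).1.
Qed.

End pointwise_cluster_points.

Theorem theorem10 (R : realType) (X : topologicalType)
  (hX : tychonoff_space X) (hws : ws_qf_space R X) :
  mu_sharp_b_complete R X.
Proof.
move=> B bB F FF FB; have [M MP] := bounded_in_pointwise bB.
(* The slack 1 pays for replacing a member of [closure B] by a nearby one of [B]. *)
have FM : (Cp_val @ F) [set g | forall y, `|g y| <= M y + 1].
  apply: (@filterS _ F) FB => b Bb y.
  have [|_ [c Bc <-] /(_ y)] := @closure_Cp_approximable _ _ B b _ [:: y] 1 ltr01.
    by move=> s r r0; exists (Cp_val b); [exists b|move=> z _; rewrite subrr normr0].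
  rewrite inE eqxx => /(_ isT) cb.
  have := ler_distD (c y) 0 (b y).
  rewrite !sub0r !normrN => /le_trans; apply.
  by apply: lerD; [exact: MP|exact: ltW].
have FG : ProperFilter (Cp_val @ F) by exact: fmap_proper_filter.
have [f Ff] := cluster_ptws_bounded FG FM.
have cf : continuous f.
  apply: (ws_qf_cluster_continuous bB hws); apply: closure_Cp_approximable.
  apply: cluster_approximable Ff _.
  by apply: (@filterS _ F) FB => b Bb; exists b.
pose f0 : Cp R X := mkcts cf.
(* Open sets of C_p(X) are preimages of pointwise open sets, so clustering lifts back along
   [Cp_val]. *)
have Ff0 : cluster F f0.
  move=> P U FP [U0 [[W oW WU] U0f] U0U].
  have [g [[b Pb <-] Wb]] : (Cp_val @` P `&` W) !=set0.
    apply: Ff.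
      by apply: (@filterS _ F) FP => b Pb; exists b.
    apply: open_nbhs_nbhs; split => //.
    by move: U0f; rewrite -WU.
  by exists b; split => //; apply: U0U; rewrite -WU.
exists f0; split => //; apply: closed_closure => U Uf0.
exact: Ff0.
Qed.
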